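(* Let 1. $\pi$ be a prior distribution on the parameter space $\mathcal{V}$; 2. $\mu_0$ be a reference probability measure on $\mathcal{X}^n$ such that $\mu_{\boldsymbol V} \ll \mu_0$ for all $\boldsymbol V \in \mathcal{V}$ (here $\mu_{\boldsymbol V}$ denotes the law on $\mathcal{X}^n$ of the $n$ i.i.d. samples held by one machine); 3. $\overline\mu$ be a null probability measure on $\mathcal{X}^n$ such that $\overline\mu$ and $\mu_0$ are mutually absolutely continuous; 4. $\mathcal{Z} \subset \mathcal{X}^n$ be an event such that $$\mathcal{Z} \subset \left\{\boldsymbol X \in \mathcal{X}^n : \left|\frac{d\overline\mu}{d\mu_0}(\boldsymbol X) - 1\right| \leq \frac12\right\},$$ and let $Z_i = \mathbb{I}_{\boldsymbol X_i \in \mathcal{Z}}$ for $i \in [m]$. For $i \in [m]$, let $\overline{\mathbb{P}}_0^{(i)}$, $\overline{\mathbb{E}}_0^{(i)}$ (and $\overline{\mathbb{E}}_0^{(i)}[\cdot \mid \cdot]$) denote probabilities and (conditional) expectations in the hypothetical setup in which the machine datasets $\boldsymbol X_{1:m}$ are independent with $\boldsymbol X_j \sim \overline\mu$ for $j \neq i$ and $\boldsymbol X_i \sim \mu_0$, and $\boldsymbol Y$ is the resulting transcript. There is a universal constant $K_{\mathsf{hel}}$ such that, if $\boldsymbol V \sim \pi$, $\boldsymbol X_{1:m} \overset{\text{i.i.d.}}{\sim} \mu_{\boldsymbol V}$ (given $\boldsymbol V$), and $\boldsymbol Y$ is the transcript produced by a distributed estimation protocol with parameters $(m,n,b)$, then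 $$\mathbf{I}_{\mathsf{hel}}(\boldsymbol V; \boldsymbol Y) \leq K_{\mathsf{hel}} \sum_{i=1}^m \overline{\mathbb{E}}_0^{(i)}\left[ Z_i \int \left(\overline{\mathbb{E}}_0^{(i)}\left[\frac{d\mu_{\boldsymbol V}}{d\mu_0}(\boldsymbol X_i) - \frac{d\overline\mu}{d\mu_0}(\boldsymbol X_i)\ \Big|\ \boldsymbol Y, Z_i, (\boldsymbol X_j)_{j\neq i}\right]\right)^2 \pi(d\boldsymbol V)\right] + \frac{m K_{\mathsf{hel}}}{2}\left(\int \mu_{\boldsymbol V}(\mathcal{Z}^c)\,\pi(d\boldsymbol V) + \overline\mu(\mathcal{Z}^c)\right).$$
   Context: **Statistical model.** $\{\mu_{\boldsymbol V} : \boldsymbol V \in \mathcal{V}\}$ is a family of probability measures on a sample space $\mathcal{X}$; the same symbol $\mu_{\boldsymbol V}$ is used for the $n$-fold product law on $\mathcal{X}^n$ of the dataset $\boldsymbol X_i = (\boldsymbol x_{i,1},\dots,\boldsymbol x_{i,n})$ of machine $i$. **Distributed estimation protocol with parameters $(m,n,b)$ (blackboard model).** There are $m$ machines, machine $i$ holding $\boldsymbol X_i \in \mathcal{X}^n$. The protocol runs for $mb$ rounds. In round $t$, a machine $\ell_t \in [m]$ is chosen as a function of the bits $\boldsymbol Y_{<t} = (Y_1,\dots,Y_{t-1})$ written so far, and it writes one bit $Y_t \in \{0,1\}$, a function of $(\boldsymbol X_{\ell_t}, \boldsymbol Y_{<t})$. Each machine is chosen in exactly $b$ rounds. The protocol is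 deterministic; the transcript is $\boldsymbol Y = (Y_1,\dots,Y_{mb}) \in \{0,1\}^{mb}$. **Hellinger information.** Let $\mathbb{P}_{\boldsymbol V}$ be the law of $\boldsymbol Y$ when $\boldsymbol X_1,\dots,\boldsymbol X_m$ are i.i.d. from $\mu_{\boldsymbol V}$. For distributions $\mathbb{P}_1,\mathbb{P}_2$ on $\{0,1\}^{mb}$, $d_{\mathsf{hel}}^2(\mathbb{P}_1,\mathbb{P}_2) = \frac12 \sum_{\boldsymbol y} \left(\sqrt{\mathbb{P}_1(\boldsymbol y)} - \sqrt{\mathbb{P}_2(\boldsymbol y)}\right)^2$. Then $$\mathbf{I}_{\mathsf{hel}}(\boldsymbol V; \boldsymbol Y) = \inf_{\mathbb{Q}} \int d_{\mathsf{hel}}^2(\mathbb{P}_{\boldsymbol V}, \mathbb{Q})\,\pi(d\boldsymbol V),$$ the infimum being over all probability measures $\mathbb{Q}$ on $\{0,1\}^{mb}$. *)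

(* Defs.v *)
From HB Require Import structures.
From mathcomp Require Import all_boot all_order all_algebra.
From mathcomp Require Import all_classical all_reals all_analysis measurable_realfun.

Set Implicit Arguments.
Unset Strict Implicit.
Unset Printing Implicit Defensive.

Import Order.TTheory GRing.Theory Num.Theory.
Import numFieldNormedType.Exports.

Local Open Scope classical_set_scope.
Local Open Scope ring_scope.

Section product_law.
Context d (T : measurableType d) (R : realType).

Definition tcons n (x : T * n.-tuple T) : n.+1.-tuple T :=
  [tuple of x.1 :: x.2].

Lemma measurable_tcons n : measurable_fun [set: T * n.-tuple T] (@tcons n).
Proof. exact: (measurable_cons measurable_fst measurable_snd). Qed.

HB.instance Definition _ n :=
  isMeasurableFun.Build _ _ _ _ (@tcons n) (@measurable_tcons n).

(* The (possibly non-identical) n-fold product measure, as a law on n-tuples. *)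
Fixpoint product_law n : ('I_n -> probability T R) ->
    probability (n.-tuple T) R :=
  match n with
  | 0 => fun _ => \d_ ([tuple] : 0.-tuple T)
  | n'.+1 => fun P =>
      distribution (P ord0 \x product_law (fun i => P (lift ord0 i)))%E
        (@tcons n')
  end.

Lemma product_lawE n (P : 'I_n -> probability T R) (A : 'I_n -> set T) :
  (forall i, measurable (A i)) ->
  product_law P [set t | forall i, A i (tnth t i)] = (\prod_(i < n) P i (A i))%E.
Proof.
elim: n P A => [|n IH] P A mA.
  rewrite big_ord0 (_ : [set _ | _] = setT) ?probability_setT//.
  by apply/seteqP; split=> // t _ [].
rewrite big_ord_recl -IH//= /distribution /pushforward.
rewrite -product_measure1E//; last first.
  rewrite (_ : [set _ | _] = \bigcap_(i in [set: 'I_n])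
      ((@tnth n T ^~ i) @^-1` A (lift ord0 i))); last first.
    by apply/seteqP; split => [t At i _|t At i]; [exact: At|exact: (At i I)].
  apply: fin_bigcap_measurable => // i _.
  by rewrite -[X in measurable X]setTI; exact: measurable_tnth.
congr (_ _); apply/seteqP; split => -[x t] /=.
  move=> At; split=> [|i]; first exact: (At ord0).
  by have := At (lift ord0 i); rewrite tnthS.
case=> Ax At i; case: (unliftP ord0 i) => [j ->|->//].
by rewrite tnthS.
Qed.

Definition iid_law n (P : probability T R) : probability (n.-tuple T) R :=
  product_law (fun _ : 'I_n => P).

End product_law.

Section densities_and_conditioning.
Context d (T : measurableType d) (R : realType).

(* A density is only determined mu-almost everywhere: f is any real-valued
   measurable version of d nu / d mu. *)
Definition is_density (nu mu : probability T R) (f : T -> R) : Prop :=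
  measurable_fun setT f /\
  ae_eq mu setT (EFin \o f)
    (Radon_Nikodym (charge_of_finite_measure nu) mu).

Definition is_cond_exp (P : probability T R) (G : set (set T)) (f h : T -> R)
    : Prop :=
  [/\ forall B : set R, measurable B -> G (h @^-1` B),
      P.-integrable setT (EFin \o h) &
      forall A, G A ->
        \int[P]_(w in A) (h w)%:E = \int[P]_(w in A) (f w)%:E]%E.

End densities_and_conditioning.

Section protocol.
Context d (X : measurableType d).

(* The first t bits on the blackboard when machine j holds tnth w j; the next
   speaker and the bit it writes may depend on the bits already written. *)
Fixpoint blackboard m n (speaker : seq bool -> 'I_m)
    (message : seq bool -> n.-tuple X -> bool)
    (w : m.-tuple (n.-tuple X)) (t : nat) : t.-tuple bool :=
  match t with
  | 0 => [tuple]
  | t'.+1 =>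
      let y := blackboard speaker message w t' in
      [tuple of rcons y (message y (tnth w (speaker y)))]
  end.

(* Only the blackboards that some dataset w produces are constrained by the
   budget; values of speaker and message on sequences of length >= m * b are
   never used. *)
Record protocol (m n b : nat) := Protocol {
  speaker : seq bool -> 'I_m;
  message : seq bool -> n.-tuple X -> bool;
  measurable_message : forall y, measurable_fun setT (message y);
  speaker_budget : forall (w : m.-tuple (n.-tuple X)) (j : 'I_m),
    #|[pred t : 'I_(m * b) | speaker (blackboard speaker message w t) == j]| = b }.

Definition transcript m n b (Pi : protocol m n b) (w : m.-tuple (n.-tuple X))
    : (m * b).-tuple bool :=
  blackboard (speaker Pi) (message Pi) w (m * b).

Lemma measurable_blackboard m n b (Pi : protocol m n b) t (y : t.-tuple bool) :
  measurable [set w | blackboard (speaker Pi) (message Pi) w t = y].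
Proof.
elim: t y => [|t IH] y.
  rewrite (_ : [set _ | _] = setT)//.
  by apply/seteqP; split=> // w _; rewrite /= (tuple0 y) tuple0.
have [s [c ys]] : exists s c, tval y = rcons s c.
  by case: y => /= r /eqP; case/lastP: r => [//|s c] _; exists s, c.
have sz : size s == t.
  by have := size_tuple y; rewrite ys size_rcons => -[->].
rewrite (_ : [set _ | _] =
  [set w | blackboard (speaker Pi) (message Pi) w t = Tuple sz] `&`
  ((@tnth m (n.-tuple X) ^~ (speaker Pi s)) @^-1`
     (message Pi s @^-1` [set c]))).
  apply: measurableI => //.
  rewrite -[X in measurable X]setTI; apply: measurable_tnth => //.
  rewrite -[X in measurable X]setTI.
  exact: (measurable_message Pi s).
apply/seteqP; split => w /=.
  move=> /(congr1 val) /=; rewrite ys => /eqP.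
  rewrite eqseq_rcons => /andP[/eqP bs /eqP mc].
  by split; [exact: val_inj|rewrite /= -[in LHS]bs].
by case=> bs mc; apply: val_inj => /=; rewrite ys bs /= mc.
Qed.

Lemma measurable_transcript m n b (Pi : protocol m n b) :
  measurable_fun setT (transcript Pi).
Proof.
move=> _ A mA; rewrite setTI.
rewrite (_ : _ @^-1` A = \bigcup_(y in A)
    [set w | transcript Pi w = y]); last first.
  apply/seteqP; split => [w Aw|w [y Ay] /= ->//].
  by exists (transcript Pi w).
apply: fin_bigcup_measurable => [|y _]; last exact: measurable_blackboard.
exact: finite_finset.
Qed.

HB.instance Definition _ m n b (Pi : protocol m n b) :=
  isMeasurableFun.Build _ _ _ _ (transcript Pi) (measurable_transcript Pi).

Definition transcript_law (R : realType) m n b (Pi : protocol m n b)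
    (P : probability (m.-tuple (n.-tuple X)) R)
    : probability ((m * b).-tuple bool) R :=
  distribution P (transcript Pi).

(* The sigma-algebra generated by the transcript, by the indicator of
   {tnth w i \in Z}, and by the data of all the machines other than i. *)
Definition conditioning_algebra m n b (Pi : protocol m n b)
    (Z : set (n.-tuple X)) (i : 'I_m) : set (set (m.-tuple (n.-tuple X))) :=
  <<s [set transcript Pi @^-1` [set y] | y in [set: (m * b).-tuple bool]]
      `|` [set [set w | Z (tnth w i)]]
      `|` [set A | exists j : 'I_m, exists B : set (n.-tuple X),
            [/\ j != i, measurable B & A = [set w | B (tnth w j)]]] >>.

End protocol.

Definition null_law d (X : measurableType d) (R : realType) m n
    (mu0 mubar : probability (n.-tuple X) R) (i : 'I_m)
    : probability (m.-tuple (n.-tuple X)) R :=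
  product_law (fun j : 'I_m => if j == i then mu0 else mubar).

Section hellinger.
Context (R : realType) (N : nat).

Definition hellinger2 (P Q : probability (N.-tuple bool) R) : R :=
  2^-1 * \sum_(y : N.-tuple bool)
    (Num.sqrt (fine (P [set y])) - Num.sqrt (fine (Q [set y]))) ^+ 2.

Definition hellinger_info d (V : measurableType d) (pi : probability V R)
    (P : V -> probability (N.-tuple bool) R) : \bar R :=
  ereal_inf [set (\int[pi]_v (hellinger2 (P v) Q)%:E)%E
            | Q in [set: probability (N.-tuple bool) R]].

End hellinger.

(* Main.v *)
Require Import Defs.
From mathcomp Require Import all_boot all_order all_algebra.
From mathcomp Require Import all_classical all_reals all_analysis measurable_realfun.
From mathcomp Require Import ring lra.

Set Implicit Arguments.
Unset Strict Implicit.
Unset Printing Implicit Defensive.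

Import Order.TTheory GRing.Theory Num.Theory.
Import numFieldNormedType.Exports.

Local Open Scope classical_set_scope.
Local Open Scope ring_scope.

(** The law of the transcript is compared with the law it has when every
    machine holds data from the null law mubar; this null transcript law is the
    competitor Q in the infimum that defines the Hellinger information.

    A deterministic protocol cuts the space of datasets into rectangles: the
    transcript equals y exactly when each machine's data lie in some set that
    depends on y and on that machine only ([transcriptP]). Hence, if the machines
    of a set S draw their data from nu and the others from mubar, the square root
    of the probability of y is a product of one factor per machine ([hybrid]).

    The product structure reduces the comparison of all machines at once to
    comparisons of one machine at a time ([hellinger_cut_paste]): with F_S the
    vector of square roots above, |F_T - F_0|^2 <= 6 sum_i |F_i - F_0|^2, where T is
    the set of all machines and 0 the empty set. Since F_S F_(~S) = F_0 F_T
    pointwise and all these vectors are unit vectors, F_T and F_0 are as far apart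
    as F_S and F_(~S), so the triangle inequality bounds |F_T - F_0|^2 by four
    times the average of |F_S - F_0|^2 over all S. That average is explicit, because
    the sum of F_S over S factors as a product over machines, and an elementary
    lower bound on a product of the form prod (1 + x_i) linearizes it.

    For one machine i ([one_machine_hellinger]), the fiber of the transcript over y
    has probability c nu(S_i) under the hybrid law and c mubar(S_i) under the null
    law, where c is the probability that the other machines are compatible with y.
    Split S_i along Z. Off Z, the squared difference of square roots is at most the
    sum of the masses, which yields the terms in the complement of Z. On Z, the
    density of mubar is at least 1/2, so the squared difference of square roots is
    at most 2 (nu(S_i Z) - mubar(S_i Z))^2 / mu0(S_i Z). The difference in this
    numerator, times c, is the integral of the conditional expectation g over the
    event that the transcript is y and the data of machine i lie in Z, an event of
    the conditioning sigma-algebra; the Cauchy-Schwarz inequality on that event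
    turns the quotient into the integral of g^2.

    Summing over y and i and integrating over the parameter, with Tonelli's theorem
    to exchange the two integrals of g^2, gives the statement with K = 6. *)

(** * Cut and paste for square roots of product probabilities *)

Section cut_and_paste.
Context (R : realType) (I : finType).
Implicit Types (u w : I -> R) (S : {set I}).

(** Multiply out: with t = x - 2 x^2, both exp t <= 1 / (1 - t) and
    1 <= (1 + x) (1 - t) hold on the given half-line. *)
Lemma expR_subsqr_le (x : R) : - 2^-1 <= x -> expR (x - 2 * x ^+ 2) <= 1 + x.
Proof.
move=> hx; set t := x - _.
have ht : 0 < 1 - t.
  have : 0 <= (4 * x - 1) ^+ 2 by exact: sqr_ge0.
  by rewrite /t; nra.
have -> : expR t = (expR (- t))^-1 by rewrite expRN invrK.
apply: (@le_trans _ _ (1 - t)^-1).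
  by rewrite lef_pV2 ?posrE ?expR_gt0// expR_ge1Dx.
rewrite -[X in X <= _]mul1r ler_pdivrMr//.
(* (1 + x) (1 - t) - 1 = x ^ 2 (1 + 2 x) *)
have : 0 <= x ^+ 2 * (1 + 2 * x) by rewrite mulr_ge0 ?sqr_ge0//; lra.
by rewrite /t; lra.
Qed.

(** Bound each factor below by an exponential, then exp s by 1 + s. Unlike a
    Bernoulli inequality, this tolerates factors of both signs of x at the price
    of a quadratic correction. *)
Lemma prod_ge_sum (x : I -> R) : (forall i, - 2^-1 <= x i) ->
  1 + \sum_i (x i - 2 * x i ^+ 2) <= \prod_i (1 + x i).
Proof.
move=> hx; apply: (le_trans (expR_ge1Dx _)).
rewrite expR_sum; apply: ler_prod => i _.
by rewrite expR_ge0 expR_subsqr_le.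
Qed.

(** When u i and w i are square roots of the masses that two laws give to the
    data of machine i compatible with a transcript, this is the square root of the
    probability of that transcript when the machines in S follow the second law. *)
Definition hybrid u w S : R := \prod_i (if i \in S then w i else u i).

Lemma hybrid0 u w : hybrid u w finset.set0 = \prod_i u i.
Proof. by apply: eq_bigr => i _; rewrite inE. Qed.

Lemma hybridT u w : hybrid u w [set: I]%SET = \prod_i w i.
Proof. by apply: eq_bigr => i _; rewrite inE. Qed.

(** The cut-and-paste property: S and its complement together use each of the
    two laws exactly once at every index. *)
Lemma hybrid_setC u w S :
  hybrid u w S * hybrid u w (~: S)%SET = hybrid u w finset.set0 * hybrid u w [set: I]%SET.
Proof.
rewrite hybrid0 hybridT /hybrid -!big_split/=; apply: eq_bigr => i _.
by rewrite inE; case: ifP => //= _; rewrite mulrC.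
Qed.

Lemma sum_hybrid u w : \sum_S hybrid u w S = \prod_i (w i + u i).
Proof. by rewrite bigA_distr. Qed.

(** After division by hybrid set0 ^+ 2, the right-hand side is the product of the
    (1 + r_i) / 2 with r_i = w_i / u_i, that is, of the 1 + x_i with
    x_i = (r_i - 1) / 2 >= - 1 / 2; apply [prod_ge_sum]. If
    hybrid set0 vanishes, the left-hand side is a sum of nonpositive terms and the
    right-hand side is 0. *)
Lemma hybrid_average_ge u w :
  (forall i, 0 <= u i) -> (forall i, 0 <= w i) ->
  hybrid u w finset.set0 ^+ 2
  + \sum_i (hybrid u w finset.set0 * (hybrid u w [set i]%SET - hybrid u w finset.set0) / 2
            - (hybrid u w [set i]%SET - hybrid u w finset.set0) ^+ 2 / 2)
  <= hybrid u w finset.set0 * (2 ^- #|I| * \sum_S hybrid u w S).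
Proof.
move=> u0 w0; rewrite sum_hybrid.
have [hz|hN0] := eqVneq (hybrid u w finset.set0) 0.
  rewrite hz expr2 !mul0r add0r; apply: sumr_le0 => i _.
  by rewrite !mul0r add0r oppr_le0 divr_ge0 ?sqr_ge0.
have uN0 i : u i != 0.
  by move: hN0; rewrite hybrid0 => /prodf_neq0; exact.
pose x i := (w i / u i - 1) / 2.
have hx i : - 2^-1 <= x i.
  by have := divr_ge0 (w0 i) (u0 i); rewrite /x; lra.
have hi i : hybrid u w [set i]%SET = hybrid u w finset.set0 * (w i / u i).
  rewrite hybrid0 /hybrid (bigD1 i)//= inE eqxx [in RHS](bigD1 i)//=.
  rewrite (eq_bigr u); last by move=> j /negPf ji; rewrite inE ji.
  by have := uN0 i; set p := \prod_(_ | _) _ => ?; field.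
have -> : 2 ^- #|I| * \prod_i (w i + u i) =
    hybrid u w finset.set0 * \prod_i (1 + x i).
  rewrite hybrid0 -big_split/=.
  rewrite -exprVn -prodr_const.
  rewrite -big_split/=; apply: eq_bigr => i _.
  by have := uN0 i; rewrite /x => ?; field.
rewrite mulrA -expr2.
apply: le_trans (ler_wpM2l (sqr_ge0 _) (prod_ge_sum hx)).
rewrite mulrDr mulr1 lerD2l mulr_sumr; apply: ler_sum => i _.
by rewrite hi /x le_eqVlt; apply/orP; left; apply/eqP; field.
Qed.

Lemma card_sets : #|{set I}| = (2 ^ #|I|)%N.
Proof. by rewrite -[#|I|]cardsT -card_powerset powersetT cardsT. Qed.

(** Replaces a change of all the laws by changes of one law at a time, at the
    cost of a constant that does not depend on their number. *)
Lemma hellinger_cut_paste (Y : finType) (u w : Y -> I -> R) :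
  (forall y i, 0 <= u y i) -> (forall y i, 0 <= w y i) ->
  (forall S, \sum_y hybrid (u y) (w y) S ^+ 2 = 1) ->
  \sum_y (hybrid (u y) (w y) [set: I]%SET - hybrid (u y) (w y) finset.set0) ^+ 2
  <= 6 * \sum_i \sum_y
       (hybrid (u y) (w y) [set i]%SET - hybrid (u y) (w y) finset.set0) ^+ 2.
Proof.
move=> u0 w0 h1; pose h S y := hybrid (u y) (w y) S.
pose D S T := \sum_y (h S y - h T y) ^+ 2.
rewrite -/(D [set: I]%SET finset.set0) -[X in _ * X]/(\sum_i D [set i]%SET finset.set0).
have DE S T : D S T = 2 - 2 * \sum_y h S y * h T y.
  rewrite /D (eq_bigr (fun y => h S y ^+ 2 + h T y ^+ 2 - 2 * (h S y * h T y))).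
    by rewrite sumrB big_split/= !h1 mulr_sumr; ring.
  by move=> y _; ring.
(* F_T, F_0 and F_S, F_(~S) have the same inner product, hence the same distance. *)
have DC S : D [set: I]%SET finset.set0 <= 2 * D S finset.set0 + 2 * D (~: S)%SET finset.set0.
  have -> : D [set: I]%SET finset.set0 = D S (~: S)%SET.
    rewrite !DE; congr (_ - _ * _); apply: eq_bigr => y _.
    by rewrite /h hybrid_setC mulrC.
  rewrite /D !mulr_sumr -big_split/=; apply: ler_sum => y _.
  have := sqr_ge0 (h S y + h (~: S)%SET y - 2 * h finset.set0 y); nra.
have Dsum : 2 ^+ #|I| * D [set: I]%SET finset.set0 <= 4 * \sum_S D S finset.set0.
  have -> : 2 ^+ #|I| * D [set: I]%SET finset.set0 = \sum_(S : {set I}) D [set: I]%SET finset.set0.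
    rewrite sumr_const -[RHS]mulr_natl; congr (_ * _).
    by rewrite card_sets natrX.
  apply: le_trans (ler_sum _ (fun S _ => DC S)) _.
  rewrite big_split/= -!mulr_sumr.
  have -> : \sum_(S : {set I}) D (~: S)%SET finset.set0 = \sum_(S : {set I}) D S finset.set0.
    by rewrite [RHS](reindex_inj (@finset.setC_inj I)).
  by lra.
(* The distance of unit vectors is affine in their inner product, so averaging
   over S only involves the average of the hybrids. *)
have avg : 2 ^- #|I| * \sum_S D S finset.set0 <= 3 / 2 * \sum_i D [set i]%SET finset.set0.
  have -> : 2 ^- #|I| * \sum_(S : {set I}) D S finset.set0 =
      2 - 2 * \sum_y h finset.set0 y * (2 ^- #|I| * \sum_S h S y).
    rewrite (eq_bigr (fun S => 2 - 2 * \sum_y h S y * h finset.set0 y)); last first.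
      by move=> S _; rewrite DE.
    rewrite sumrB sumr_const -[2 *+ _]mulr_natl.
    rewrite card_sets natrX mulrBr.
    rewrite mulrA mulVf ?mul1r; last by rewrite expf_neq0.
    congr (_ - _); rewrite -mulr_sumr mulrCA; congr (_ * _).
    rewrite exchange_big/= mulr_sumr; apply: eq_bigr => y _.
    by rewrite -mulr_suml; ring.
  have : \sum_y (h finset.set0 y ^+ 2 + \sum_i
        (h finset.set0 y * (h [set i]%SET y - h finset.set0 y) / 2
         - (h [set i]%SET y - h finset.set0 y) ^+ 2 / 2))
      <= \sum_y h finset.set0 y * (2 ^- #|I| * \sum_S h S y).
    by apply: ler_sum => y _; exact: hybrid_average_ge.
  rewrite big_split/= h1 exchange_big/=.
  set L := \sum_(j in I) _; set M := \sum_(i : Y) _.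
  have -> : L = - (3 / 4 * \sum_i D [set i]%SET finset.set0).
    rewrite mulr_sumr -sumrN; apply: eq_bigr => i _.
    rewrite sumrB -!mulr_suml.
    rewrite (eq_bigr (fun y => h [set i]%SET y * h finset.set0 y - h finset.set0 y ^+ 2)).
      rewrite sumrB h1 -[X in _ - X]/(D [set i]%SET finset.set0 / 2).
      by rewrite !DE; lra.
    by move=> y _; rewrite /h; ring.
  by lra.
have p : (0 : R) < 2 ^+ #|I| by rewrite exprn_gt0.
rewrite -(ler_pM2l p); apply: (le_trans Dsum).
move: avg; rewrite ler_pdivrMl//; lra.
Qed.

End cut_and_paste.

(** * Integrals against a product law *)

Section product_law_integral.
Context d (T : measurableType d) (R : realType).
Local Open Scope ereal_scope.

Lemma measurable_prod_tnth n (F : 'I_n -> T -> \bar R) :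
  (forall i, measurable_fun setT (F i)) ->
  measurable_fun setT (fun t : n.-tuple T => \prod_i F i (tnth t i)).
Proof.
move=> mF; rewrite (_ : (fun _ => _) =
    (fun t => \big[mule/1]_(i <- index_enum 'I_n) F i (tnth t i))) //.
elim: (index_enum _) => [|i s IH].
  by under eq_fun do rewrite big_nil; exact: measurable_cst.
under eq_fun do rewrite big_cons.
apply: emeasurable_funM => //; apply: measurableT_comp => //.
exact: measurable_tnth.
Qed.

(** Tonelli's theorem along the recursive construction of the product law. *)
Lemma integral_product_law n (P : 'I_n -> probability T R)
    (F : 'I_n -> T -> \bar R) :
  (forall i, measurable_fun setT (F i)) -> (forall i x, 0 <= F i x) ->
  \int[product_law P]_t (\prod_i F i (tnth t i)) = \prod_i \int[P i]_x F i x.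
Proof.
elim: n P F => [|n IH] P F mF F0.
  under eq_integral do rewrite big_ord0.
  by rewrite big_ord0 integral_cst//= mul1e probability_setT.
rewrite big_ord_recl -IH//= ge0_integral_pushforward//; last 2 first.
- exact: (measurable_prod_tnth mF).
- by move=> t _; apply: prode_ge0.
pose G (z : T * n.-tuple T) : \bar R :=
  F ord0 z.1 * \prod_i F (lift ord0 i) (tnth z.2 i).
rewrite preimage_setT (eq_integral G); last first.
  move=> z _ /=; rewrite big_ord_recl /G; congr (_ * _).
  by apply: eq_bigr => i _; rewrite tnthS.
have mlift : measurable_fun setT
    (fun t : n.-tuple T => \prod_i F (lift ord0 i) (tnth t i)).
  exact: (@measurable_prod_tnth _ (fun i => F (lift ord0 i))).
rewrite fubini_tonelli1//=; last 2 first.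
- apply: emeasurable_funM; first by apply: measurableT_comp; [exact: mF|exact: measurable_fst].
  by apply: (measurableT_comp mlift); exact: measurable_snd.
- by move=> z; apply: mule_ge0 => //; exact: prode_ge0.
rewrite /fubini_F /G/=.
under eq_integral => x _.
  rewrite ge0_integralZl//; last by move=> t _; exact: prode_ge0.
  over.
rewrite ge0_integralZr//.
by apply: integral_ge0 => t _; exact: prode_ge0.
Qed.

(** Independence in integral form; [integral_product_law] applied to h times an
    indicator at index i and to indicators elsewhere. *)
Lemma ge0_integral_product_law_rect n (P : 'I_n -> probability T R)
    (A : 'I_n -> set T) (i : 'I_n) (h : T -> \bar R) :
  (forall j, measurable (A j)) -> measurable_fun setT h ->
  (forall x, 0 <= h x) ->
  \int[product_law P]_(t in [set t | forall j, A j (tnth t j)]) h (tnth t i) =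
  \prod_(j | j != i) P j (A j) * \int[P i]_(x in A i) h x.
Proof.
move=> mA mh h0.
pose F j x : \bar R := if j == i then (h \_ (A j)) x else (\1_(A j) x)%:E.
have mF j : measurable_fun setT (F j).
  rewrite /F; case: eqP => _; last by apply/measurable_EFinP.
  by apply/(measurable_restrictT _ (mA j)); exact: measurable_funTS.
have F0 j x : 0 <= F j x.
  rewrite /F; case: eqP => _; last by rewrite lee_fin.
  by rewrite patchE; case: ifP.
rewrite integral_mkcond (eq_integral (fun t => \prod_j F j (tnth t j))).
  rewrite integral_product_law// (bigD1 i)//= muleC; congr (_ * _).
    apply: eq_bigr => j /negPf ji; rewrite /F ji integral_indic ?setIT//.
  by rewrite /F eqxx -integral_mkcond.
move=> t _; rewrite patchE; case: ifPn => [/set_mem /= At|].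
  rewrite (bigD1 i)//= /F eqxx patchE mem_set// big1 ?mule1//.
  by move=> j /negPf ji; rewrite ji indicE mem_set.
move=> tA; have [j tj] : exists j, ~ A j (tnth t j).
  by apply/existsNP; apply: contraNnot tA => ?; rewrite inE.
rewrite (bigD1 j)//= [F j _](_ : _ = 0) ?mul0e// /F.
by case: eqP => _; rewrite ?patchE ?indicE memNset.
Qed.

Lemma integral_product_law_rect n (P : 'I_n -> probability T R)
    (A : 'I_n -> set T) (i : 'I_n) (h : T -> \bar R) :
  (forall j, measurable (A j)) -> (P i).-integrable setT h ->
  \int[product_law P]_(t in [set t | forall j, A j (tnth t j)]) h (tnth t i) =
  \prod_(j | j != i) P j (A j) * \int[P i]_(x in A i) h x.
Proof.
move=> mA ih; have mh := measurable_int _ ih.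
have ihA : (P i).-integrable (A i) h by exact: integrableS ih.
rewrite integralE [in RHS]integralE.
have -> : (fun t : n.-tuple T => h (tnth t i))^\+ = h^\+ \o (fun t => tnth t i).
  by rewrite -funepos_comp.
have -> : (fun t : n.-tuple T => h (tnth t i))^\- = h^\- \o (fun t => tnth t i).
  by rewrite -funeneg_comp.
rewrite !ge0_integral_product_law_rect//; last 2 first.
- exact: measurable_funeneg.
- exact: measurable_funepos.
apply/esym/muleBr; first by apply: prode_fin_num => j _; exact: fin_num_measure.
apply: fin_num_adde_defr; apply: integrable_fin_num => //.
exact: integrable_funepos.
Qed.

End product_law_integral.

(** * Rectangle structure of transcripts *)

Section transcript_rectangle.
Context d (X : measurableType d) (m n b : nat) (Pi : protocol X m n b).

(** The data with which machine i, whenever it speaks along the blackboard y,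
    writes the bit found in y. *)
Definition compatible (y : seq bool) (i : 'I_m) : set (n.-tuple X) :=
  [set x | forall t, (t < size y)%N -> speaker Pi (take t y) = i ->
    message Pi (take t y) x = nth false y t].

Lemma measurable_compatible y i : measurable (compatible y i).
Proof.
rewrite (_ : compatible y i = \bigcap_(t in [set t | (t < size y)%N /\
    speaker Pi (take t y) = i])
  (message Pi (take t y) @^-1` [set nth false y t])); last first.
  by apply/seteqP; split => x /= h t; [case; exact: h|move=> *; exact: h].
apply: bigcap_measurableType => t _.
by rewrite -[X in measurable X]setTI; exact: (measurable_message Pi).
Qed.

Lemma blackboardP w (y : seq bool) :
  tval (blackboard (speaker Pi) (message Pi) w (size y)) = y <->
  forall i, compatible y i (tnth w i).
Proof.
elim/last_ind: y => [|y c IH].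
  by split=> [_ i t //|_]; exact: size0nil (size_tuple _).
rewrite size_rcons /=; split=> [/eqP|h].
  rewrite eqseq_rcons => /andP[/eqP by_ /eqP mc] i t.
  rewrite size_rcons ltnS leq_eqVlt => /orP[/eqP ->|ty].
    rewrite -cats1 take_size_cat// nth_cat ltnn subnn/= => si.
    by move: mc; rewrite by_ si.
  rewrite -cats1 takel_cat ?(ltnW ty)// nth_cat ty => si.
  exact: (IH.1 by_).
have by_ : tval (blackboard (speaker Pi) (message Pi) w (size y)) = y.
  apply/IH => i t ty si.
  have := h i t; rewrite size_rcons ltnS (ltnW ty) -cats1 takel_cat ?(ltnW ty)//.
  by rewrite nth_cat ty; exact.
rewrite by_; congr rcons.
have := h (speaker Pi y) (size y); rewrite size_rcons ltnSn -cats1.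
by rewrite take_size_cat// nth_cat ltnn subnn/=; exact.
Qed.

(** The rectangle property: each bit depends only on the data of its speaker, who
    is determined by the earlier bits. *)
Lemma transcriptP w (y : (m * b).-tuple bool) :
  transcript Pi w = y <-> forall i, compatible y i (tnth w i).
Proof.
have := blackboardP w y; rewrite size_tuple => h.
by split => [/(congr1 val)/h//|/h/val_inj].
Qed.

Context (R : realType).
Implicit Types P : 'I_m -> probability (n.-tuple X) R.

Lemma transcript_lawE P (y : (m * b).-tuple bool) :
  transcript_law Pi (product_law P) [set y] =
  (\prod_(i < m) P i (compatible y i))%E.
Proof.
rewrite -product_lawE => [|i]; last exact: measurable_compatible.
by congr (product_law P _); apply/seteqP; split => w /= /transcriptP.
Qed.

End transcript_rectangle.

Section fibers.
Context d (T : measurableType d) (R : realType) (mu : {measure set T -> \bar R}).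
Context (Y : finType) (phi : T -> Y) (B : set T).
Hypotheses (mphi : forall y, measurable (phi @^-1` [set y])) (mB : measurable B).

Let cover_fibers : B = \big[setU/set0]_(y : Y) (phi @^-1` [set y] `&` B).
Proof.
rewrite -bigcup_seq; apply/seteqP; split => [x Bx|x [y _ []//]].
by exists (phi x); [rewrite /= mem_index_enum|split].
Qed.

Let triv_fibers : trivIset [set` index_enum Y] (fun y => phi @^-1` [set y] `&` B).
Proof. by move=> y z _ _ [x [[/= <- _] [/= <- _]]]. Qed.

Lemma sum_integral_fibers (h : T -> \bar R) : measurable_fun setT h ->
  (forall x, 0 <= h x)%E ->
  (\sum_(y : Y) \int[mu]_(x in phi @^-1` [set y] `&` B) h x =
   \int[mu]_(x in B) h x)%E.
Proof.
move=> mh h0; rewrite [in RHS]cover_fibers ge0_integral_bigsetU//.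
- by move=> y; exact: measurableI.
- exact: index_enum_uniq.
- exact: measurable_funTS.
Qed.

Lemma sum_measure_fibers :
  (\sum_(y : Y) mu (phi @^-1` [set y] `&` B) = mu B)%E.
Proof.
rewrite -[RHS]mul1e -integral_cst// -sum_integral_fibers//.
apply: eq_bigr => y _; rewrite integral_cst ?mul1e//; exact: measurableI.
Qed.

End fibers.

(** * Densities, Cauchy-Schwarz and scalar bounds *)

Section density.
Context d (T : measurableType d) (R : realType).
Context (nu mu : probability T R) (f : T -> R).
Hypotheses (numu : nu `<< mu) (fE : is_density nu mu f).
Local Open Scope ereal_scope.

Lemma integrable_density : mu.-integrable setT (EFin \o f).
Proof.
case: fE => mf aef.
have /integrableP[mRN iRN] : mu.-integrable setT
    (Radon_Nikodym (charge_of_finite_measure nu) mu).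
  exact: Radon_Nikodym_integrable.
apply/integrableP; split; first exact/measurable_EFinP.
rewrite (_ : integral _ _ _ = \int[mu]_x
  `|Radon_Nikodym (charge_of_finite_measure nu) mu x|)//.
apply: ae_eq_integral => //.
- by apply: measurableT_comp => //; exact/measurable_EFinP.
- exact: measurableT_comp.
- exact: (ae_eq_comp abse aef).
Qed.

Lemma integral_density A : measurable A -> \int[mu]_(x in A) (f x)%:E = nu A.
Proof.
move=> mA; case: fE => mf aef.
rewrite [RHS](@Radon_Nikodym_integral _ _ _ (charge_of_finite_measure nu) mu)//.
have mRN : measurable_fun setT (Radon_Nikodym (charge_of_finite_measure nu) mu).
  by apply: (measurable_int mu); exact: Radon_Nikodym_integrable.
apply: ae_eq_integral => //.
- by apply: measurable_funTS; exact/measurable_EFinP.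
- exact: measurable_funTS.
- exact: ae_eq_subset aef.
Qed.

End density.

(** The Cauchy-Schwarz inequality on A in linearized form, the integral of
    (g - l)^2 >= 0; optimizing over l recovers the usual form. It also
    holds when the right-hand side is infinite. *)
Lemma integral_sqr_ge d (T : measurableType d) (R : realType)
    (mu : {finite_measure set T -> \bar R}) (A : set T) (g : T -> R) (l : R) :
  measurable A -> mu.-integrable A (EFin \o g) ->
  ((2 * l)%:E * \int[mu]_(x in A) (g x)%:E - (l ^+ 2)%:E * mu A
   <= \int[mu]_(x in A) ((g x) ^+ 2)%:E)%E.
Proof.
move=> mA ig; have mg : measurable_fun A g.
  by have /measurable_EFinP := measurable_int _ ig.
have mg2 : measurable_fun A (fun x => ((g x) ^+ 2)%:E).
  by apply/measurable_EFinP; exact: measurable_funX.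
have [goo|gfin] := eqVneq (\int[mu]_(x in A) ((g x) ^+ 2)%:E)%E +oo%E.
  by rewrite goo leey.
have ig2 : mu.-integrable A (fun x => ((g x) ^+ 2)%:E).
  apply/integrableP; split=> //.
  under eq_integral do rewrite gee0_abs ?lee_fin ?sqr_ge0//.
  by rewrite ltey.
have i1 := integrableZl mA (2 * l) ig.
have i2 : mu.-integrable A (EFin \o cst (l ^+ 2)).
  exact: finite_measure_integrable_cst.
rewrite -integralZl// -integral_cst// -integralB//=.
apply: le_integral => //; first exact: (integrableB mA i1 i2).
move=> x _ /=; rewrite -EFinM -EFinB lee_fin.
  by have := sqr_ge0 (g x - l); lra.
Qed.

Section scalar.
Context (R : realType).
Implicit Types a b c e : R.

(** The map sending masses to squared Hellinger distance is subadditive under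
    merging two cells, and on the second cell the distance is at most the mass. *)
Lemma sqr_sqrt_subD a a' b b' : 0 <= a -> 0 <= a' -> 0 <= b -> 0 <= b' ->
  (Num.sqrt (a + a') - Num.sqrt (b + b')) ^+ 2 <=
  (Num.sqrt a - Num.sqrt b) ^+ 2 + (a' + b').
Proof.
move=> a0 a'0 b0 b'0.
have h : Num.sqrt a * Num.sqrt b <= Num.sqrt (a + a') * Num.sqrt (b + b').
  by rewrite ler_pM ?sqrtr_ge0// ler_sqrt ?addr_ge0// lerDl.
have := sqr_sqrtr (addr_ge0 a0 a'0); have := sqr_sqrtr (addr_ge0 b0 b'0).
by have := sqr_sqrtr a0; have := sqr_sqrtr b0; nra.
Qed.

(** a - b is the difference of the square roots times their sum, and that sum is
    at least the square root of b. *)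
Lemma sqr_sqrt_subM a b : 0 <= a -> 0 <= b ->
  (Num.sqrt a - Num.sqrt b) ^+ 2 * b <= (a - b) ^+ 2.
Proof.
move=> a0 b0; rewrite -{2}(sqr_sqrtr b0) -{2}(sqr_sqrtr a0) -{3}(sqr_sqrtr b0).
rewrite subr_sqr exprMn ler_wpM2l ?sqr_ge0// ler_sqr ?nnegrE ?sqrtr_ge0//.
by rewrite lerDr sqrtr_ge0.
Qed.

(** The form in which the linearized Cauchy-Schwarz inequality is used: take
    l = (a - b) / e. Here a, b and e are the masses of one event under the model,
    null and reference laws. *)
Lemma sqr_sqrt_sub_le a b c e (G : \bar R) :
  0 <= a -> 0 <= b -> 0 <= c -> 0 <= e ->
  e <= 2 * b -> (e = 0 -> a = 0 /\ b = 0) ->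
  (forall l, (2 * l * (c * (a - b)) - l ^+ 2 * (c * e))%:E <= G)%E ->
  ((2^-1 * (c * (Num.sqrt a - Num.sqrt b) ^+ 2))%:E <= G)%E.
Proof.
move=> a0 b0 c0 e0 eb e0ab hG; have [ez|eN0] := eqVneq e 0.
  have [-> ->] := e0ab ez.
  by apply: le_trans (hG 0); rewrite lee_fin subrr expr2 !mulr0 !mul0r subrr.
have e_gt0 : 0 < e by rewrite lt0r eN0.
apply: le_trans (hG ((a - b) / e)); rewrite lee_fin.
have -> : 2 * ((a - b) / e) * (c * (a - b)) - ((a - b) / e) ^+ 2 * (c * e) =
    c * (a - b) ^+ 2 / e by field.
rewrite ler_pdivlMr//.
have h1 := ler_wpM2l c0 (sqr_sqrt_subM a0 b0).
have h2 := ler_wpM2l (mulr_ge0 c0 (sqr_ge0 (Num.sqrt a - Num.sqrt b))) eb.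
by lra.
Qed.

End scalar.

(** * Laws in which one machine departs from the null law *)

Section one_machine.
Context d (X : measurableType d) (R : realType) (m n b : nat).
Context (Pi : protocol X m n b) (mubar : probability (n.-tuple X) R) (i : 'I_m).
Implicit Types (rho : probability (n.-tuple X) R) (B : set (n.-tuple X)).
Implicit Types (y : (m * b).-tuple bool).

(** Under every law in which machines other than i draw from mubar, this is the
    probability that those machines are compatible with y. *)
Definition others_prob y : R :=
  \prod_(j | j != i) fine (mubar (compatible Pi y j)).

Lemma others_prob_ge0 y : 0 <= others_prob y.
Proof. by apply: prodr_ge0 => j _; rewrite fine_ge0. Qed.

Let box y B (j : 'I_m) : set (n.-tuple X) :=
  if j == i then compatible Pi y j `&` B else compatible Pi y j.

Let measurable_box y B j : measurable B -> measurable (box y B j).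
Proof.
move=> mB; rewrite /box; case: ifP => _; last exact: measurable_compatible.
by apply: measurableI => //; exact: measurable_compatible.
Qed.

Let boxE y B : transcript Pi @^-1` [set y] `&` [set w | B (tnth w i)] =
  [set w | forall j, box y B j (tnth w j)].
Proof.
apply/seteqP; split=> w /=.
  case=> /transcriptP wy Bw j; rewrite /box; case: eqP => [->|_]; last exact: wy.
  by split.
move=> h; split; last by have := h i; rewrite /box eqxx => -[].
by apply/transcriptP => j; have := h j; rewrite /box; case: ifP => // _ [].
Qed.

Let others_boxE rho y B :
  (\prod_(j | j != i) (if j == i then rho else mubar) (box y B j))%E =
  (others_prob y)%:E.
Proof.
rewrite -prodEFin; apply: eq_bigr => j /negPf ji; rewrite /box ji fineK//.
by apply: fin_num_measure; exact: measurable_compatible.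
Qed.

Lemma null_law_rect rho y B : measurable B ->
  null_law rho mubar i (transcript Pi @^-1` [set y] `&` [set w | B (tnth w i)]) =
  ((others_prob y)%:E * rho (compatible Pi y i `&` B))%E.
Proof.
move=> mB; rewrite boxE /null_law product_lawE => [|j]; last exact: measurable_box.
by rewrite (bigD1 i)//= others_boxE muleC /box eqxx.
Qed.

Lemma integral_null_law_rect rho y B (h : n.-tuple X -> \bar R) :
  measurable B -> rho.-integrable setT h ->
  (\int[null_law rho mubar i]_(w in
     transcript Pi @^-1` [set y] `&` [set w | B (tnth w i)]) h (tnth w i) =
  (others_prob y)%:E * \int[rho]_(x in compatible Pi y i `&` B) h x)%E.
Proof.
move=> mB ih; rewrite boxE /null_law integral_product_law_rect//.
- by rewrite others_boxE /box eqxx.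
- by move=> j; exact: measurable_box.
- by rewrite eqxx.
Qed.

Lemma null_law_marginal rho B : measurable B ->
  null_law rho mubar i [set w | B (tnth w i)] = rho B.
Proof.
move=> mB.
have := @product_lawE _ _ _ _ (fun j => if j == i then rho else mubar)
  (fun j => if j == i then B else setT).
rewrite (bigD1 i)//= eqxx big1 ?mule1 => [<-|j /negPf ->]; last first.
- exact: probability_setT.
- by move=> j; case: ifP.
congr (product_law _ _); apply/seteqP; split=> w /=.
  by move=> Bw j; case: eqP => [->|].
by move=> /(_ i); rewrite eqxx.
Qed.

(** The fibers of the transcript partition the event that machine i's data lie
    in B. *)
Lemma sum_others_prob rho B : measurable B ->
  (\sum_y (others_prob y)%:E * rho (compatible Pi y i `&` B) = rho B)%E.
Proof.
move=> mB; rewrite -(null_law_marginal rho mB).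
have mBi : measurable [set w : m.-tuple (n.-tuple X) | B (tnth w i)].
  by rewrite -[X in measurable X]setTI; exact: measurable_tnth.
rewrite -(sum_measure_fibers (null_law rho mubar i) (phi := transcript Pi) _ mBi).
  by apply: eq_bigr => y _; exact/esym/null_law_rect.
by move=> y; exact: measurable_blackboard.
Qed.

Lemma conditioning_algebra_rect Z y :
  conditioning_algebra Pi Z i
    (transcript Pi @^-1` [set y] `&` [set w | Z (tnth w i)]).
Proof.
rewrite /conditioning_algebra; set G := (X in <<s X >>).
have sG : sigma_algebra setT <<s G >> by exact: smallest_sigma_algebra.
have [_ _ _ sGI] := (sigma_algebraP (fun E _ => @subsetT _ E)).1 sG.
apply: sGI; apply: sub_sigma_algebra; left.
- by left; exists y.
- by right.
Qed.

End one_machine.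

(** * Hellinger distance when one machine is changed *)

Section one_machine_hellinger.
Context d (X : measurableType d) (R : realType) (m n b : nat).
Context (Pi : protocol X m n b) (mu0 mubar nu : probability (n.-tuple X) R).
Context (f fbar : n.-tuple X -> R) (Z : set (n.-tuple X)) (i : 'I_m).
Context (g : m.-tuple (n.-tuple X) -> R).
Hypotheses (nu0 : nu `<< mu0) (mubar0 : mubar `<< mu0).
Hypotheses (fE : is_density nu mu0 f) (fbarE : is_density mubar mu0 fbar).
Hypotheses (mZ : measurable Z) (Zfbar : Z `<=` [set x | `|fbar x - 1| <= 2^-1]).
Hypothesis gE : is_cond_exp (null_law mu0 mubar i) (conditioning_algebra Pi Z i)
  (fun w => f (tnth w i) - fbar (tnth w i)) g.

Definition sqrt_prob (rho : probability (n.-tuple X) R) (y : seq bool) (j : 'I_m) : R :=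
  Num.sqrt (fine (rho (compatible Pi y j))).

Lemma sqrt_prob_ge0 (rho : probability (n.-tuple X) R) y j : 0 <= sqrt_prob rho y j.
Proof. exact: sqrtr_ge0. Qed.

Let fin_prob (rho : probability (n.-tuple X) R) A : measurable A ->
  rho A = (fine (rho A))%:E.
Proof. by move=> mA; rewrite fineK//; exact: fin_num_measure. Qed.

(** On Z the density of mubar with respect to mu0 is at least 1 / 2. *)
Lemma reference_le_null B : measurable B -> B `<=` Z ->
  (mu0 B <= 2%:E * mubar B)%E.
Proof.
move=> mB BZ; rewrite -(integral_density mubar0 fbarE mB).
have ifbar : mu0.-integrable B (EFin \o fbar).
  by apply: integrableS (integrable_density mubar0 fbarE).
rewrite -integralZl// -[leLHS]mul1e -integral_cst//.
apply: le_integral => //.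
- exact: finite_measure_integrable_cst.
- exact: integrableZl.
- move=> x /set_mem Bx; rewrite -EFinM lee_fin.
  by have /= := Zfbar (BZ _ Bx); rewrite ler_norml => /andP[]; lra.
Qed.

(** The event belongs to the conditioning sigma-algebra, so g may be replaced by
    the difference of densities, which depends on machine i only. *)
Lemma integral_cond_exp_rect (y : (m * b).-tuple bool) :
  (\int[null_law mu0 mubar i]_(w in
     transcript Pi @^-1` [set y] `&` [set w | Z (tnth w i)]) (g w)%:E =
  (others_prob Pi mubar i y)%:E *
    (nu (compatible Pi y i `&` Z) - mubar (compatible Pi y i `&` Z)))%E.
Proof.
case: gE => _ _ -> //; last exact: conditioning_algebra_rect.
have mS : measurable (compatible Pi y i `&` Z).
  by apply: measurableI => //; exact: measurable_compatible.
under eq_integral do rewrite EFinB.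
have if1 := integrable_density nu0 fE.
have if2 := integrable_density mubar0 fbarE.
rewrite (@integral_null_law_rect _ _ _ _ _ _ _ mubar i mu0 y Z
  (fun x => (f x)%:E - (fbar x)%:E)%E)//.
  congr (_ * _)%E; rewrite integralB//=.
  - by rewrite (integral_density nu0 fE)// (integral_density mubar0 fbarE).
  - exact: integrableS if1.
  - exact: integrableS if2.
exact: integrableB.
Qed.

(** The event that machine i's data are compatible with y is split along Z; the
    part outside Z is bounded by its mass, the part inside by the integral of
    g^2 over the fiber. *)
Lemma one_machine_hellinger_fiber (y : (m * b).-tuple bool) :
  ((2^-1 * (hybrid (sqrt_prob mubar y) (sqrt_prob nu y) [set i]%SET -
            hybrid (sqrt_prob mubar y) (sqrt_prob nu y) finset.set0) ^+ 2)%:E <=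
   \int[null_law mu0 mubar i]_(w in
     transcript Pi @^-1` [set y] `&` [set w | Z (tnth w i)]) (g w ^+ 2)%:E +
   (2^-1)%:E * ((others_prob Pi mubar i y)%:E * nu (compatible Pi y i `&` ~` Z) +
     (others_prob Pi mubar i y)%:E * mubar (compatible Pi y i `&` ~` Z)))%E.
Proof.
set u := sqrt_prob mubar y; set w := sqrt_prob nu y.
have mS : measurable (compatible Pi y i) by exact: measurable_compatible.
have mSZ : measurable (compatible Pi y i `&` Z) by exact: measurableI.
have mSC : measurable (compatible Pi y i `&` ~` Z).
  by apply: measurableI => //; exact: measurableC.
set c := others_prob Pi mubar i y.
have c0 : 0 <= c by exact: others_prob_ge0.
pose p (rho : probability (n.-tuple X) R) := fine (rho (compatible Pi y i `&` Z)).
pose q (rho : probability (n.-tuple X) R) :=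
  fine (rho (compatible Pi y i `&` ~` Z)).
have pq (rho : probability (n.-tuple X) R) : fine (rho (compatible Pi y i)) = p rho + q rho.
  rewrite /p /q -fineD; try exact: fin_num_measure.
  rewrite -measureU//; last by rewrite setIACA setICr setI0.
  by rewrite -setIUr setUv setIT.
have p0 (rho : probability (n.-tuple X) R) : 0 <= p rho by exact: fine_ge0.
have q0 (rho : probability (n.-tuple X) R) : 0 <= q rho by exact: fine_ge0.
have hybE : (hybrid u w [set i]%SET - hybrid u w finset.set0) ^+ 2 =
    c * (Num.sqrt (p nu + q nu) - Num.sqrt (p mubar + q mubar)) ^+ 2.
  rewrite hybrid0 /hybrid (bigD1 i)//= inE eqxx [X in _ - X](bigD1 i)//=.
  rewrite (eq_bigr u); last by move=> j /negPf ji; rewrite inE ji.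
  rewrite -mulrBl exprMn mulrC -!pq; congr (_ * _).
  rewrite -prodrXl; apply: eq_bigr => j _.
  by rewrite /u sqr_sqrtr// fine_ge0.
rewrite hybE (fin_prob nu mSC) (fin_prob mubar mSC) -/(q nu) -/(q mubar).
rewrite -!EFinM.
have := sqr_sqrt_subD (p0 nu) (q0 nu) (p0 mubar) (q0 mubar) => hsplit.
apply: (@le_trans _ _ ((2^-1 * (c * (Num.sqrt (p nu) - Num.sqrt (p mubar)) ^+ 2))%:E
   + (2^-1 * (c * q nu + c * q mubar))%:E)%E).
  rewrite -EFinD lee_fin.
  by have := ler_wpM2l c0 hsplit; lra.
rewrite leeD2r//.
apply: (@sqr_sqrt_sub_le _ _ _ _ (p mu0)) => //.
- by rewrite -lee_fin EFinM /p -(fin_prob mu0 mSZ) -(fin_prob mubar mSZ); exact: reference_le_null.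
- move=> e0; have z : mu0 (compatible Pi y i `&` Z) = 0%E.
    by rewrite (fin_prob mu0 mSZ) -/(p mu0) e0.
  have nz := (measure0_null_setP mu0 mSZ).2 z.
  by split; rewrite /p ((measure0_null_setP _ mSZ).1 _)//; [exact: nu0|exact: mubar0].
- move=> l; case: gE => _ ig _.
  have mA : measurable (transcript Pi @^-1` [set y] `&` [set w | Z (tnth w i)]).
    apply: measurableI; first exact: measurable_blackboard.
    by rewrite -[X in measurable X]setTI; exact: measurable_tnth.
  have igA := integrableS measurableT mA (@subsetT _ _) ig.
  apply: le_trans (integral_sqr_ge l mA igA).
  rewrite integral_cond_exp_rect.
  rewrite [X in (_ <= _ - _ * X)%E](null_law_rect Pi mubar i mu0 y mZ).
  rewrite (fin_prob nu mSZ) (fin_prob mubar mSZ) (fin_prob mu0 mSZ) -/(p nu) -/(p mubar) -/(p mu0) -/c.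
  exact: lexx.
Qed.

(** Replacing mubar by nu at machine i alone moves the transcript law by at most
    the information that the transcript keeps about this replacement on Z, plus
    the masses that both laws leave outside Z. *)
Lemma one_machine_hellinger :
  ((2^-1 * \sum_(y : (m * b).-tuple bool)
     (hybrid (sqrt_prob mubar y) (sqrt_prob nu y) [set i]%SET -
      hybrid (sqrt_prob mubar y) (sqrt_prob nu y) finset.set0) ^+ 2)%:E <=
   \int[null_law mu0 mubar i]_w ((\1_Z (tnth w i))%:E * (g w ^+ 2)%:E) +
   (2^-1)%:E * (nu (~` Z) + mubar (~` Z)))%E.
Proof.
have mZi : measurable [set w : m.-tuple (n.-tuple X) | Z (tnth w i)].
  by rewrite -[X in measurable X]setTI; exact: measurable_tnth.
have mCZ : measurable (~` Z) by exact: measurableC.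
rewrite (_ : (\int[_]_w _)%E = \int[null_law mu0 mubar i]_(w in
    [set w | Z (tnth w i)]) (g w ^+ 2)%:E)%E; last first.
  rewrite [RHS]integral_mkcond epatch_indic; apply: eq_integral => w _ /=.
  by rewrite muleC.
have mg : measurable_fun setT (fun w => (g w ^+ 2)%:E).
  apply/measurable_EFinP; apply: measurable_funX.
  by case: gE => _ /measurable_int /measurable_EFinP.
rewrite -(sum_integral_fibers _ (phi := transcript Pi) _ mZi mg); last 2 first.
- by move=> y; exact: measurable_blackboard.
- by move=> w; rewrite lee_fin sqr_ge0.
rewrite -(sum_others_prob Pi mubar i nu mCZ) -(sum_others_prob Pi mubar i mubar mCZ).
rewrite -big_split/= ge0_sume_distrr; last first.
  by move=> y _; rewrite adde_ge0// mule_ge0// lee_fin others_prob_ge0.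
rewrite -big_split/= mulr_sumr -sumEFin; apply: lee_sum => y _.
exact: one_machine_hellinger_fiber.
Qed.

End one_machine_hellinger.

(** * Hellinger distance when all machines are changed, and measurability *)

Section transcript_hellinger.
Context d (X : measurableType d) (R : realType) (m n b : nat).
Context (Pi : protocol X m n b) (mubar nu : probability (n.-tuple X) R).

Lemma hybrid_sqrt_probE (S : {set 'I_m}) (y : (m * b).-tuple bool) :
  hybrid (sqrt_prob Pi mubar y) (sqrt_prob Pi nu y) S =
  Num.sqrt (fine (transcript_law Pi
    (product_law (fun j => if j \in S then nu else mubar)) [set y])).
Proof.
rewrite transcript_lawE.
rewrite (eq_bigr (fun j => (fine ((if j \in S then nu else mubar)
    (compatible Pi y j)))%:E)); last first.
  by move=> j _; rewrite fineK//; apply: fin_num_measure;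
    exact: measurable_compatible.
rewrite prodEFin/= /hybrid.
rewrite [RHS](_ : _ = \prod_j
    Num.sqrt (fine ((if j \in S then nu else mubar) (compatible Pi y j)))).
  by apply: eq_bigr => j _; rewrite /sqrt_prob; case: ifP.
elim: (index_enum _) => [|j s IH]; first by rewrite !big_nil sqrtr1.
by rewrite !big_cons sqrtrM ?fine_ge0// IH.
Qed.

Lemma hellinger2_transcript_le :
  hellinger2 (transcript_law Pi (iid_law m nu)) (transcript_law Pi (iid_law m mubar))
  <= 6 * \sum_i (2^-1 * \sum_(y : (m * b).-tuple bool)
     (hybrid (sqrt_prob Pi mubar y) (sqrt_prob Pi nu y) [set i]%SET -
      hybrid (sqrt_prob Pi mubar y) (sqrt_prob Pi nu y) finset.set0) ^+ 2).
Proof.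
rewrite /hellinger2 -mulr_sumr mulrCA ler_wpM2l//.
have := @hellinger_cut_paste R 'I_m ((m * b).-tuple bool)
  (fun y => sqrt_prob Pi mubar y) (fun y => sqrt_prob Pi nu y).
move=> /(_ (fun _ _ => sqrt_prob_ge0 _ _ _ _) (fun _ _ => sqrt_prob_ge0 _ _ _ _)).
have h1 S : \sum_(y : (m * b).-tuple bool)
    hybrid (sqrt_prob Pi mubar y) (sqrt_prob Pi nu y) S ^+ 2 = 1.
  pose P : probability (m.-tuple (n.-tuple X)) R :=
    product_law (fun j => if j \in S then nu else mubar).
  apply: EFin_inj; rewrite -sumEFin -(probability_setT P).
  rewrite -(sum_measure_fibers P (phi := transcript Pi) _ measurableT).
    apply: eq_bigr => y _; rewrite hybrid_sqrt_probE sqr_sqrtr ?fine_ge0//.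
    rewrite setIT fineK//.
    exact: (fin_num_measure P _ (measurable_blackboard Pi y)).
  by move=> y; exact: measurable_blackboard.
move=> /(_ h1); apply: le_trans; rewrite le_eqVlt; apply/orP; left; apply/eqP.
apply: eq_bigr => y _; rewrite !hybrid_sqrt_probE /iid_law.
congr ((_ - _) ^+ 2); congr (Num.sqrt (fine (transcript_law _ (product_law _) _)));
  by apply/funext => j; rewrite inE.
Qed.

End transcript_hellinger.

Lemma measurable_hellinger2_transcript dV dX (V : measurableType dV)
    (X : measurableType dX) (R : realType) (m n b : nat) (Pi : protocol X m n b)
    (nu : V -> probability (n.-tuple X) R)
    (Q : probability ((m * b).-tuple bool) R) :
  (forall A, measurable A -> measurable_fun setT (nu ^~ A)) ->
  measurable_fun setT
    (fun v => (hellinger2 (transcript_law Pi (iid_law m (nu v))) Q)%:E).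
Proof.
move=> mnu; apply/measurable_EFinP; apply: measurable_funM => //.
apply: measurable_sum => y; apply: measurable_funX; apply: measurable_funB => //.
apply: (measurableT_comp (continuous_measurable_fun (@sqrt_continuous R))).
apply: (measurableT_comp (fine_measurable measurableT)).
under eq_fun do rewrite transcript_lawE.
elim: (index_enum _) => [|i s IH].
  by under eq_fun do rewrite big_nil; exact: measurable_cst.
under eq_fun do rewrite big_cons.
by apply: emeasurable_funM => //; apply: mnu; exact: measurable_compatible.
Qed.

Section measurable_law.
Context dV dX (V : measurableType dV) (X : measurableType dX) (R : realType).
Context (n : nat) (mu : V -> probability X R).
Hypothesis mmu : forall A : set X, measurable A -> measurable_fun setT (mu ^~ A).
Local Open Scope ereal_scope.

Let rectangles : set (set (n.-tuple X)) :=
  [set B | exists A : 'I_n -> set X, (forall i, measurable (A i)) /\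
    B = [set t | forall i, A i (tnth t i)]].

Let measurable_rectangles : @measurable _ (n.-tuple X) = <<s rectangles >>.
Proof.
apply/seteqP; split.
- apply: smallest_sub; first exact: smallest_sigma_algebra.
  rewrite -bigcup_seq; apply: bigcup_sub => i _ _ [B mB <-].
  apply: sub_sigma_algebra; exists (fun j => if j == i then B else setT); split.
    by move=> j; case: ifP.
  rewrite setTI; apply/seteqP; split => t /=.
    by move=> Bt j; case: eqP => [->|].
  by move=> /(_ i); rewrite eqxx.
- apply: smallest_sub; first exact: sigma_algebra_measurable.
  move=> _ [A [mA ->]].
  rewrite (_ : [set _ | _] = \bigcap_(i in [set: 'I_n])
      ((@tnth n X ^~ i) @^-1` A i)); last first.
    by apply/seteqP; split => [t At i _|t At i]; [exact: At|exact: (At i I)].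
  apply: fin_bigcap_measurable => // i _.
  by rewrite -[X in measurable X]setTI; exact: measurable_tnth.
Qed.

(** The sets for which the claim holds form a Dynkin system, and rectangles
    generate the product sigma-algebra. *)
Lemma measurable_iid_law (A : set (n.-tuple X)) : measurable A ->
  measurable_fun setT (fun v => iid_law n (mu v) A).
Proof.
move=> mA; have : <<s rectangles >> A by rewrite -measurable_rectangles.
apply: (dynkin_induction (P := fun A => measurable_fun setT
    (fun v => iid_law n (mu v) A)) measurable_rectangles).
- move=> _ _ [A1 [mA1 ->]] [A2 [mA2 ->]]; exists (fun i => A1 i `&` A2 i); split.
    by move=> i; exact: measurableI.
  apply/seteqP; split => t /=; first by case=> h1 h2 i; split.
  by move=> h; split => i; case: (h i).
- by under eq_fun do rewrite probability_setT; exact: measurable_cst.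
- move=> _ [B [mB ->]]; under eq_fun do rewrite product_lawE//.
  elim: (index_enum _) => [|i s IH].
    by under eq_fun do rewrite big_nil; exact: measurable_cst.
  under eq_fun do rewrite big_cons.
  by apply: emeasurable_funM => //; exact: mmu.
- move=> B mB mPB; under eq_fun do rewrite probability_setC//.
  by apply: emeasurable_funB => //; exact: measurable_cst.
- move=> F mF tF mPF; under eq_fun do rewrite measure_bigcup//.
  by apply: ge0_emeasurable_sum => [k v _ _|k _]; [exact: measure_ge0|exact: mPF].
Qed.

End measurable_law.

(** * Hellinger information *)

Theorem proposition1 (R : realType) :
  exists K : R, 0 < K /\
  forall (dV dX : measure_display)
    (V : measurableType dV) (X : measurableType dX) (m n b : nat)
    (pi : probability V R) (mu : V -> probability X R)
    (mu0 mubar : probability (n.-tuple X) R)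
    (f : V -> n.-tuple X -> R) (fbar : n.-tuple X -> R)
    (Z : set (n.-tuple X)) (Pi : protocol X m n b)
    (g : 'I_m -> V -> m.-tuple (n.-tuple X) -> R),
  (forall A : set X, measurable A -> measurable_fun [set: V] (mu ^~ A)) ->
  (forall v, iid_law n (mu v) `<< mu0) ->
  mubar `<< mu0 -> mu0 `<< mubar ->
  (forall v, is_density (iid_law n (mu v)) mu0 (f v)) ->
  is_density mubar mu0 fbar ->
  measurable Z ->
  Z `<=` [set x | `|fbar x - 1| <= 2^-1] ->
  (forall i : 'I_m,
    measurable_fun setT
      (fun vw : V * m.-tuple (n.-tuple X) => g i vw.1 vw.2) /\
    forall v, is_cond_exp (null_law mu0 mubar i) (conditioning_algebra Pi Z i)
      (fun w => f v (tnth w i) - fbar (tnth w i)) (g i v)) ->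
  (hellinger_info pi
     (fun v => transcript_law Pi (iid_law m (iid_law n (mu v))))
   <= K%:E * (\sum_(i < m) \int[null_law mu0 mubar i]_w
        ((\1_Z (tnth w i))%:E * \int[pi]_v ((g i v w) ^+ 2)%:E))
      + (m%:R * K / 2)%:E *
        (\int[pi]_v iid_law n (mu v) (~` Z) + mubar (~` Z)))%E.
Proof.
exists 6; split=> // dV dX V X m n b pi mu mu0 mubar f fbar Z Pi g mmu nu0
  mubar0 _ fE fbarE mZ Zfbar gE.
have mCZ : measurable (~` Z) by exact: measurableC.
pose Q := transcript_law Pi (iid_law m mubar).
apply: (@le_trans _ _ (\int[pi]_v (hellinger2
    (transcript_law Pi (iid_law m (iid_law n (mu v)))) Q)%:E)%E).
  by apply: ereal_inf_lbound; exists Q.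
(* The integrand of the information term, before the integration over v has been
   moved inside. *)
pose err (v : V) (w : m.-tuple (n.-tuple X)) i : \bar R :=
  ((\1_Z (tnth w i))%:E * (g i v w ^+ 2)%:E)%E.
have err0 v w i : (0 <= err v w i)%E.
  by rewrite /err -EFinM lee_fin mulr_ge0 ?sqr_ge0// indicE ler0n.
have merr i : measurable_fun setT
    (fun vw : V * m.-tuple (n.-tuple X) => err vw.1 vw.2 i).
  have [mg _] := gE i.
  apply/measurable_EFinP; apply: measurable_funM.
    have m1 : measurable_fun setT (\1_Z : _ -> R) by exact: measurable_indic.
    have m2 : measurable_fun setT
        (fun vw : V * m.-tuple (n.-tuple X) => tnth vw.2 i).
      by apply: (measurableT_comp (measurable_tnth i)); exact: measurable_snd.
    exact: (measurableT_comp m1 m2).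
  exact: measurable_funX.
pose bad v : \bar R := (iid_law n (mu v) (~` Z) + mubar (~` Z))%E.
have bad0 v : (0 <= bad v)%E by exact: adde_ge0.
have mbad : measurable_fun setT bad.
  by apply: emeasurable_funD; [exact: measurable_iid_law|exact: measurable_cst].
pose E v i : \bar R := (\int[null_law mu0 mubar i]_w err v w i)%E.
have E0 v i : (0 <= E v i)%E by exact: integral_ge0.
have mE i : measurable_fun setT (E ^~ i).
  exact: (@measurable_fun_fubini_tonelli_F _ _ _ _ _ (null_law mu0 mubar i)
    (fun vw => err vw.1 vw.2 i)).
have bound v : ((hellinger2 (transcript_law Pi (iid_law m (iid_law n (mu v)))) Q)%:E
    <= 6%:E * \sum_(i < m) (E v i + (2^-1)%:E * bad v))%E.
  apply: (@le_trans _ _ _ _ _ (_ : (_ <= (6 * \sum_i _)%:E)%E)).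
    by rewrite lee_fin; exact: hellinger2_transcript_le.
  rewrite EFinM -sumEFin lee_pmul2l//; apply: lee_sum => i _.
  exact: (one_machine_hellinger (nu0 v) mubar0 (fE v) fbarE mZ Zfbar ((gE i).2 v)).
have mEbad i : measurable_fun setT (fun v => E v i + (2^-1)%:E * bad v)%E.
  by apply: emeasurable_funD => //; exact: measurable_funeM.
have Ebad0 v i : (0 <= E v i + (2^-1)%:E * bad v)%E.
  by rewrite adde_ge0// mule_ge0// lee_fin.
apply: (@le_trans _ _ (\int[pi]_v
    (6%:E * \sum_(i < m) (E v i + (2^-1)%:E * bad v)))%E).
  apply: ge0_le_integral => //.
  - by move=> v _; rewrite lee_fin mulr_ge0// sumr_ge0// => y _; exact: sqr_ge0.
  - by apply: measurable_hellinger2_transcript => A; exact: measurable_iid_law.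
  - by apply: measurable_funeM; exact: emeasurable_sum.
rewrite ge0_integralZl//; last 2 first.
- exact: emeasurable_sum.
- by move=> v _; exact: sume_ge0.
rewrite ge0_integral_sum//.
have intEbad i : (\int[pi]_v (E v i + (2^-1)%:E * bad v) =
    \int[null_law mu0 mubar i]_w
      ((\1_Z (tnth w i))%:E * \int[pi]_v ((g i v w) ^+ 2)%:E) +
    (2^-1)%:E * (\int[pi]_v iid_law n (mu v) (~` Z) + mubar (~` Z)))%E.
  rewrite ge0_integralD//; last 2 first.
  - by move=> v _; rewrite mule_ge0// lee_fin.
  - exact: measurable_funeM.
  congr (_ + _)%E.
    rewrite (fubini_tonelli (fun vw => err vw.1 vw.2 i))//=.
    apply: eq_integral => w _; rewrite ge0_integralZl//.
    - apply/measurable_EFinP; apply: measurable_funX.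
      by have [mg _] := gE i; exact: (measurableT_comp mg (pair2_measurable w)).
    - by move=> v _; rewrite lee_fin sqr_ge0.
  rewrite ge0_integralZl// ge0_integralD//; last exact: measurable_iid_law.
  congr (_ * (_ + _))%E; rewrite integral_cst//.
  by rewrite [X in (_ * X)%E](probability_setT pi) mule1.
rewrite (eq_bigr _ (fun i _ => intEbad i)) big_split/=.
set B := (\int[pi]_v _ + _)%E.
have B0 : (0 <= B)%E by apply: adde_ge0 => //; exact: integral_ge0.
rewrite ge0_muleDr; last 2 first.
- apply: sume_ge0 => i _; apply: integral_ge0 => w _; apply: mule_ge0.
    by rewrite lee_fin indicE ler0n.
  by apply: integral_ge0 => v _; rewrite lee_fin sqr_ge0.
- by apply: sume_ge0 => i _; rewrite mule_ge0// lee_fin.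
rewrite leeD2l// -ge0_sume_distrl; last by move=> i _; rewrite lee_fin.
rewrite muleA sumEFin -EFinM sumr_const card_ord.
by rewrite -[X in (6 * X)]mulr_natl mulrCA mulrA.
Qed.
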